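(* Let $\lambda,\mu,\delta>0$ and let $q$ be the solution of the linear impulsive differential equation $$\frac{dq}{dt}(t)=\lambda-\mu q(t)\quad (t\neq t_k),\qquad q(t_k^+)-q(t_k^-)=b\,q(t_k^-),\qquad t_k=k\delta,\ k\in\mathbb{N},$$ with initial value $q(0)=q_0\ge 0$. Let $L$ and $U$ be the lower and upper values of $q$ in steady state. If $-1<b<0$ and $(1+b)e^{-\mu\delta}<1$, then $$L=\frac{\lambda(1+b)}{\mu}\left(\frac{1-e^{-\mu\delta}}{1-(1+b)e^{-\mu\delta}}\right),\qquad U=\frac{\lambda}{\mu}\left(\frac{1-e^{-\mu\delta}}{1-(1+b)e^{-\mu\delta}}\right).$$ Moreover, if $0\le b<e^{\mu\delta}-1$, then the two values are switched, i.e. $$L=\frac{\lambda}{\mu}\left(\frac{1-e^{-\mu\delta}}{1-(1+b)e^{-\mu\delta}}\right),\qquad U=\frac{\lambda(1+b)}{\mu}\left(\frac{1-e^{-\mu\delta}}{1-(1+b)e^{-\mu\delta}}\right).$$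
   Context: Here $\lambda$ is the arrival rate, $\mu$ the service rate, $b$ the proportional jump magnitude, and $\delta=t_k-t_{k-1}$ the time between impulses; $q(t_k^-)$ and $q(t_k^+)$ denote the left and right limits of $q$ at the impulse time $t_k$. The lower and upper values in steady state are the long-run extreme values of the solution, $L=\liminf_{t\to\infty}q(t)$ and $U=\limsup_{t\to\infty}q(t)$; in steady state these are attained just before or just after the impulses. *)

(* Defs.v *)
From HB Require Import structures.
From mathcomp Require Import all_boot all_order all_algebra.
From mathcomp Require Import all_classical all_reals all_analysis.

Set Implicit Arguments.
Unset Strict Implicit.
Unset Printing Implicit Defensive.

Import Order.TTheory GRing.Theory Num.Theory.
Import numFieldNormedType.Exports.

Local Open Scope classical_set_scope.
Local Open Scope ring_scope.

(* The impulse times are the positive multiples of delta: k = 0 is left out,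
   since the evolution starts at time 0 with the prescribed value q0. *)
Definition impulse_time (R : realType) (delta : R) (k : nat) : R := k%:R * delta.

Definition is_impulse_time (R : realType) (delta t : R) : Prop :=
  exists2 k : nat, (0 < k)%N & t = impulse_time delta k.

(* A solution on [0, +oo[; the values of q at negative times are irrelevant.
   At an impulse time the equation only involves the two one-sided limits.
   The value q t_k itself may be either of them, which covers both the
   left-continuous and the right-continuous convention. *)
Record impulsive_solution (R : realType) (lambda mu b delta q0 : R)
    (q : R -> R) : Prop := ImpulsiveSolution {
  impulsive_init : q 0 = q0;
  impulsive_init_cont : q t @[t --> 0^'+] --> q0;
  impulsive_ode : forall t : R, 0 < t -> ~ is_impulse_time delta t ->
    is_derive t (1 : R) q (lambda - mu * q t);
  impulsive_jump : forall k : nat, (0 < k)%N ->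
    exists qminus qplus : R,
      [/\ q t @[t --> (impulse_time delta k)^'-] --> qminus,
          q t @[t --> (impulse_time delta k)^'+] --> qplus,
          qplus - qminus = b * qminus &
          q (impulse_time delta k) = qminus \/
          q (impulse_time delta k) = qplus]
}.

Definition steady_lower (R : realType) (q : R -> R) : \bar R :=
  limf_einf (fun t : R => (q t)%:E) (pinfty_nbhs R).

Definition steady_upper (R : realType) (q : R -> R) : \bar R :=
  limf_esup (fun t : R => (q t)%:E) (pinfty_nbhs R).

(* Main.v *)
(* Between consecutive impulses q relaxes exponentially towards lambda / mu, so
   it stays between the right limit p_k at t_k and the left limit m_k at t_(k+1).
   The left limits satisfy the affine recurrence
     m_(k+1) = lambda / mu * (1 - E) + (1 + b) * E * m_k,  E = exp (- mu * delta),
   which is a contraction; hence m_k tends to its fixed point A and p_k tends to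
   (1 + b) * A. The lower and upper limits of q are therefore the minimum and
   the maximum of A and (1 + b) * A, and the sign of b tells which is which. *)
Require Import Defs.
From HB Require Import structures.
From mathcomp Require Import all_boot all_order all_algebra.
From mathcomp Require Import all_classical all_reals all_analysis.
From mathcomp Require Import ring lra.

Set Implicit Arguments.
Unset Strict Implicit.
Unset Printing Implicit Defensive.

Import Order.TTheory GRing.Theory Num.Theory.
Import numFieldNormedType.Exports.

Local Open Scope classical_set_scope.
Local Open Scope ring_scope.

(** * Limits along a filter and of an affine recurrence *)

(** The upper limit is the infimum over [A] in [F] of the suprema of [f] on [A]: the first
    hypothesis makes one of these at most [l + e], the second makes all of them at least [l - e]. *)
Lemma limf_esup_fin (R : realType) (f : R -> R) (F : set_system R)
    {FF : Filter F} (l : R) :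
  (forall e, 0 < e -> \forall t \near F, f t <= l + e) ->
  (forall e, 0 < e -> forall A, F A -> exists2 t, A t & l - e <= f t) ->
  limf_esup (fun t => (f t)%:E) F = l%:E.
Proof.
move=> ub freq; apply/eqP; rewrite eq_le; apply/andP; split.
  apply/lee_addgt0Pr => e e0; apply: ge_ereal_inf.
  exists (ereal_sup [set (f t)%:E | t in [set t | f t <= l + e]]).
    by exists [set t | f t <= l + e] => //; exact: ub.
  by apply: ge_ereal_sup => _ [t /= ft <-]; rewrite -EFinD lee_fin.
apply: le_ereal_inf_tmp => _ [A FA <-]; apply/lee_subgt0Pr => e e0.
have [t At let_] := freq _ e0 _ FA.
by apply: le_ereal_sup_tmp; exists (f t)%:E; [exists t|rewrite -EFinB lee_fin].
Qed.

Lemma limf_einf_fin (R : realType) (f : R -> R) (F : set_system R)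
    {FF : Filter F} (l : R) :
  (forall e, 0 < e -> \forall t \near F, l - e <= f t) ->
  (forall e, 0 < e -> forall A, F A -> exists2 t, A t & f t <= l + e) ->
  limf_einf (fun t => (f t)%:E) F = l%:E.
Proof.
move=> lb freq; rewrite /limf_einf -[RHS]oppeK; congr (- _)%E.
apply: (@limf_esup_fin R (fun t => - f t)) => e e0.
  by apply: filterS (lb _ e0) => t; rewrite -[- l + e]opprK lerN2 opprD opprK.
move=> A FA; have [t At ft] := freq _ e0 _ FA; exists t => //.
by rewrite -opprD lerN2.
Qed.

(** The deviation of [u] from the fixed point is geometric with ratio [r]. *)
Lemma affine_recurrence_cvg (R : archiRealFieldType) (u : R ^nat) (r s : R) :
  `|r| < 1 -> (forall n, u n.+1 = s + r * u n) -> u @ \oo --> s / (1 - r).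
Proof.
move=> r1 uS; have r1' : 1 - r != 0.
  by rewrite subr_eq0 eq_sym lt_eqF// (le_lt_trans (ler_norm _)).
set l := s / (1 - r).
have -> : u = (fun n => l + geometric (u 0%N - l) r n).
  apply/funext; elim=> [|n IHn]; first by rewrite /= expr0 mulr1 subrKC.
  by rewrite uS IHn /= exprS /l; field.
rewrite -[X in _ --> X]addr0.
by apply: cvgD; [exact: cvg_cst|exact: cvg_geometric].
Qed.

(** * The linear equation on an interval without impulses *)

(** With the integrating factor [expR (mu * t)], the deviation of [q] from [lambda / mu] becomes a
    function [h] of zero derivative, hence a constant, which is [K]. *)
Lemma linear_ode_sol (R : realType) (lambda mu a c : R) (q : R -> R) :
  mu != 0 ->
  (forall t, a < t < c -> is_derive t (1 : R) q (lambda - mu * q t)) ->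
  exists K, forall t, a < t < c -> q t = lambda / mu + K * expR (- (mu * t)).
Proof.
move=> mu0 dq.
pose h t := (q t - lambda / mu) * expR (mu * t).
have dh t : a < t < c -> is_derive t (1 : R) h 0.
  move=> /dq dqt.
  rewrite (_ : h = (q - cst (lambda / mu)) * (expR \o (mu \*: id))) //.
  have dexp : is_derive t (1 : R) (expR \o (mu \*: id)) (expR (mu * t) * mu).
    by apply: is_derive1_comp; apply: is_derive_eq; rewrite /GRing.scale/= mulr1.
  by apply: is_derive_eq; rewrite /GRing.scale/= !fctE/=; field.
have hcst x y : a < x < c -> a < y < c -> x <= y -> h y = h x.
  move=> /andP[ax _] /andP[_ yc] xy.
  have sub t : t \in `[x, y] -> a < t < c.
    rewrite in_itv/= => /andP[xt ty].
    by rewrite (lt_le_trans ax)// (le_lt_trans ty).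
  have [||_ _ /eqP] := @MVT_segment _ h (fun=> 0) x y xy.
  - by move=> t /subset_itv_oo_cc /sub /dh.
  - by apply: derivable_within_continuous => t /sub /dh [].
  - by rewrite mul0r subr_eq0 => /eqP.
have [ac|ca] := ltP a c; last first.
  by exists 0 => t /andP[at_ tc]; move: (lt_trans at_ tc); rewrite ltNge ca.
(* The midpoint only serves as a reference point at which to read off the constant. *)
have acm : a < (a + c) / 2 < c by rewrite !midf_lt.
exists (h ((a + c) / 2)) => t act.
have -> : h ((a + c) / 2) = h t.
  by have [?|/ltW ?] := leP t ((a + c) / 2); [|symmetry]; exact: hcst.
by rewrite /h -mulrA -expRD subrr expR0 mulr1 subrKC.
Qed.

(** The explicit solution [g] is continuous on the whole line, so [p] and [m] are its values at [a]
    and [c]; the bounds hold because [g] is monotone. *)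
Lemma linear_ode_limits (R : realType) (lambda mu a c p m : R) (q : R -> R) :
  0 < mu -> a < c ->
  (forall t, a < t < c -> is_derive t (1 : R) q (lambda - mu * q t)) ->
  q t @[t --> a^'+] --> p -> q t @[t --> c^'-] --> m ->
  m = lambda / mu + (p - lambda / mu) * expR (- (mu * (c - a))) /\
  forall t, a < t < c -> Num.min p m <= q t <= Num.max p m.
Proof.
move=> mu0 ac /(linear_ode_sol (lt0r_neq0 mu0))[K qE] qp qm.
pose g t := lambda / mu + K * expR (- (mu * t)).
have cg x : g t @[t --> x] --> g x.
  apply: cvgD; first exact: cvg_cst.
  apply: cvgM; first exact: cvg_cst.
  apply: continuous_comp; last exact: continuous_expR.
  by apply: cvgN; apply: cvgM; [exact: cvg_cst|exact: cvg_id].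
have pE : p = g a.
  apply: (cvg_unique (@Rhausdorff R) qp).
  apply: cvg_trans (cvg_at_right_filter (cg a)); apply: near_eq_cvg.
  near=> t; rewrite /g -qE//; apply/andP; split; near: t.
    exact: nbhs_right_gt.
  exact: nbhs_right_lt.
have mE : m = g c.
  apply: (cvg_unique (@Rhausdorff R) qm).
  apply: cvg_trans (cvg_at_left_filter (cg c)); apply: near_eq_cvg.
  near=> t; rewrite /g -qE//; apply/andP; split; near: t.
    exact: nbhs_left_gt.
  exact: nbhs_left_lt.
split.
  rewrite mE pE /g [X in (X - _) * _]addrC addrK -mulrA -expRD.
  by congr (_ + _ * expR _); ring.
move=> t act; rewrite (qE t act) pE mE /g.
have [at_ tc] := andP act.
have ec : expR (- (mu * c)) <= expR (- (mu * t)).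
  by rewrite ler_expR lerN2 ler_pM2l// ltW.
have ea : expR (- (mu * t)) <= expR (- (mu * a)).
  by rewrite ler_expR lerN2 ler_pM2l// ltW.
rewrite ge_min le_max !lerD2l.
(* The sign of [K] decides whether [g] decreases from [p] to [m] or increases. *)
have [K0|/ltW K0] := leP 0 K.
  by rewrite (ler_wpM2l K0 ec) (ler_wpM2l K0 ea) orbT.
by rewrite (ler_wnM2l K0 ec) (ler_wnM2l K0 ea) orbT.
Unshelve. all: by end_near. Qed.

(** * One-sided limits at the impulses *)

Lemma no_impulse_between (R : realType) (delta t : R) (k : nat) : 0 < delta ->
  impulse_time delta k < t < impulse_time delta k.+1 ->
  ~ is_impulse_time delta t.
Proof.
move=> d0 /andP[kt tk] [j _ tj]; move: kt tk.
by rewrite tj /impulse_time !ltr_pM2r// !ltr_nat ltnS ltnNge => /negbTE->.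
Qed.

(* Indices are shifted: p k is a limit at t_k and m k a limit at t_(k+1). *)
Lemma impulsive_one_sided_limits (R : realType) (lambda mu b delta q0 : R)
    (q : R -> R) :
  impulsive_solution lambda mu b delta q0 q ->
  exists m p : nat -> R, [/\
    forall k, q t @[t --> (impulse_time delta k)^'+] --> p k,
    forall k, q t @[t --> (impulse_time delta k.+1)^'-] --> m k,
    forall k, p k.+1 = (1 + b) * m k &
    forall k, q (impulse_time delta k.+1) = m k \/
              q (impulse_time delta k.+1) = p k.+1].
Proof.
case=> qi qc _ qj.
have /choice[m mP] k : exists m, exists p,
    [/\ q t @[t --> (impulse_time delta k.+1)^'-] --> m,
        q t @[t --> (impulse_time delta k.+1)^'+] --> p,
        p - m = b * m &
        q (impulse_time delta k.+1) = m \/ q (impulse_time delta k.+1) = p].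
  exact: qj.
have /choice[p pP] := mP.
(* There is no jump at time 0, so the right limit there is the initial value [q0]. *)
exists m, (fun k => if k is j.+1 then p j else q0); split=> [[|k]|k|k|k].
- by rewrite /impulse_time mul0r.
- by case: (pP k).
- by case: (pP k).
- by case: (pP k) => _ _ /eqP; rewrite subr_eq mulrDl mul1r addrC => /eqP.
- by case: (pP k).
Qed.

(** The filters [G k] stand for left neighbourhoods of t_(k+1) or right neighbourhoods of t_k. Both
    lie eventually beyond t_k, which exceeds any [M] for large [k]; the error [e] is split between
    [u k] to [v] and [q t] to [u k]. *)
Lemma frequently_near_limit (R : realType) (delta v : R) (q : R -> R)
    (u : R ^nat) (G : nat -> set_system R) {FG : forall k, ProperFilter (G k)} :
  0 < delta -> u @ \oo --> v -> (forall k, q t @[t --> G k] --> u k) ->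
  (forall k, \forall t \near G k, impulse_time delta k < t) ->
  forall e, 0 < e -> forall A, pinfty_nbhs R A ->
  exists2 t, A t & v - e <= q t <= v + e.
Proof.
move=> d0 uv qu Gk e e0 A [M [_ MA]].
have e20 : 0 < e / 2 by rewrite divr_gt0.
near \oo => k.
have uk : `|v - u k| < e / 2 by near: k; exact: cvgr_dist_lt.
have kM : M < impulse_time delta k.
  by rewrite /impulse_time -ltr_pdivrMr//; near: k; exact: nbhs_infty_gtr.
have [t [tk qt]] := filter_ex (filterI (Gk k) (cvgr_dist_lt _ _ (qu k) _ e20)).
exists t; first exact: MA (lt_trans kM tk).
by rewrite -ler_distlC (splitr e) (le_trans (ler_distD (u k) _ _))// lerD// ltW.
Unshelve. all: by end_near. Qed.

(** * The steady state *)

Lemma impulsive_steady_state (R : realType) (lambda mu b delta q0 : R)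
    (q : R -> R) (E := expR (- (mu * delta)))
    (A := lambda / mu * ((1 - E) / (1 - (1 + b) * E))) :
  0 < mu -> 0 < delta -> `|(1 + b) * E| < 1 ->
  impulsive_solution lambda mu b delta q0 q ->
  steady_lower q = (Num.min A ((1 + b) * A))%:E /\
  steady_upper q = (Num.max A ((1 + b) * A))%:E.
Proof.
move=> mu0 d0 r1 qs.
have [m [p [qp qm pm qt]]] := impulsive_one_sided_limits qs.
have tS k : impulse_time delta k.+1 - impulse_time delta k = delta.
  by rewrite /impulse_time -natr1 mulrDl mul1r addrAC subrr add0r.
have t_lt k : impulse_time delta k < impulse_time delta k.+1.
  by rewrite -subr_gt0 tS.
have t_ge0 k : 0 <= impulse_time delta k by rewrite mulr_ge0 ?ler0n// ltW.
have seg k : m k = lambda / mu + (p k - lambda / mu) * E /\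
    forall t, impulse_time delta k < t < impulse_time delta k.+1 ->
      Num.min (p k) (m k) <= q t <= Num.max (p k) (m k).
  rewrite /E -[in X in expR X](tS k).
  apply: (linear_ode_limits mu0 (t_lt k) _ (qp k) (qm k)) => t tk.
  apply: (impulsive_ode qs); last exact: no_impulse_between tk.
  by case/andP: tk => + _; exact: le_lt_trans.
have mA : m @ \oo --> A.
  rewrite /A mulrA; apply: affine_recurrence_cvg => // n.
  by rewrite (seg _).1 pm; ring.
have pA : p @ \oo --> (1 + b) * A.
  (* The shift drops [p 0], which comes from the initial value and not from a jump. *)
  rewrite -cvg_shiftS; under eq_fun do rewrite pm.
  by apply: cvgM => //; exact: cvg_cst.
have bounds e : 0 < e -> \forall t \near +oo,
    Num.min A ((1 + b) * A) - e <= q t <= Num.max A ((1 + b) * A) + e.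
  move=> e0; set lo := _ - e; set hi := _ + e.
  have bnd : \forall k \near \oo, (lo <= m k <= hi) && (lo <= p k <= hi).
    have near_lohi (u : R ^nat) v : u @ \oo --> v -> lo < v -> v < hi ->
        \forall k \near \oo, lo <= u k <= hi.
      move=> uv lov vhi; near=> k; apply/andP; split; near: k.
        exact: (cvgr_ge _ uv).
      exact: (cvgr_le _ uv).
    near=> k; apply/andP; split; near: k;
      [apply: (near_lohi _ _ mA)|apply: (near_lohi _ _ pA)];
      by rewrite /lo/hi ?ltrBlDr ltr_pwDr// (ge_min, le_max) lexx ?orbT.
  have [N _ Nbnd] := bnd.
  (* Starting at t_(N+1) makes the index of the last impulse up to [t] a successor [k.+1] with
     [k >= N], so that [m k], the left limit at that impulse, is bounded too. *)
  near=> t.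
  have tN : impulse_time delta N.+1 <= t.
    by near: t; apply: nbhs_pinfty_ge; exact: num_real.
  have td0 : 0 <= t / delta by rewrite divr_ge0 ?ltW// (le_trans (t_ge0 N.+1)).
  have := truncn_itv td0; rewrite ler_pdivlMr// ltr_pdivrMr//.
  have : (N < Num.truncn (t / delta))%N by rewrite truncn_gt_nat ler_pdivlMr.
  case: (Num.truncn _) => [//|k] Nk /andP[kt tk].
  have /andP[/andP[lom mhi] _] := Nbnd k Nk.
  have /andP[/andP[lomS mShi] /andP[lopS pShi]] := Nbnd k.+1 (leqW Nk).
  (* Either [t] is an impulse time, where [q] takes one of the two limits, or it lies strictly
     between two impulses. *)
  move: kt; rewrite le_eqVlt => /predU1P[<-|kt].
    by case: (qt k) => ->; apply/andP.
  have /andP[ql qh] := (seg k.+1).2 t (introT andP (conj kt tk)).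
  by rewrite (le_trans _ ql) ?le_min ?lopS// (le_trans qh)// ge_max pShi.
have freqA : forall e, 0 < e -> forall B, pinfty_nbhs R B ->
    exists2 t, B t & A - e <= q t <= A + e.
  apply: (frequently_near_limit d0 mA qm) => k.
    exact: at_left_proper_filter.
  exact: nbhs_left_gt.
have freqbA : forall e, 0 < e -> forall B, pinfty_nbhs R B ->
    exists2 t, B t & (1 + b) * A - e <= q t <= (1 + b) * A + e.
  apply: (frequently_near_limit d0 pA qp) => k.
    exact: at_right_proper_filter.
  exact: nbhs_right_gt.
split.
  apply: limf_einf_fin => e e0.
    by apply: filterS (bounds _ e0) => t /andP[].
  move=> B FB; rewrite minEle; case: ifP => _.
    by have [t Bt /andP[_ ?]] := freqA _ e0 _ FB; exists t.
  by have [t Bt /andP[_ ?]] := freqbA _ e0 _ FB; exists t.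
apply: limf_esup_fin => e e0.
  by apply: filterS (bounds _ e0) => t /andP[].
move=> B FB; rewrite maxEle; case: ifP => _.
  by have [t Bt /andP[? _]] := freqbA _ e0 _ FB; exists t.
by have [t Bt /andP[? _]] := freqA _ e0 _ FB; exists t.
Unshelve. all: by end_near. Qed.

Theorem theorem2p3 (R : realType) (lambda mu b delta q0 : R) (q : R -> R)
    (lambda_gt0 : 0 < lambda) (mu_gt0 : 0 < mu) (delta_gt0 : 0 < delta)
    (q0_ge0 : 0 <= q0)
    (q_sol : impulsive_solution lambda mu b delta q0 q) :
  (-1 < b -> b < 0 -> (1 + b) * expR (- (mu * delta)) < 1 ->
     steady_lower q =
       (lambda * (1 + b) / mu *
         ((1 - expR (- (mu * delta))) /
          (1 - (1 + b) * expR (- (mu * delta)))))%:E /\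
     steady_upper q =
       (lambda / mu *
         ((1 - expR (- (mu * delta))) /
          (1 - (1 + b) * expR (- (mu * delta)))))%:E) /\
  (0 <= b -> b < expR (mu * delta) - 1 ->
     steady_lower q =
       (lambda / mu *
         ((1 - expR (- (mu * delta))) /
          (1 - (1 + b) * expR (- (mu * delta)))))%:E /\
     steady_upper q =
       (lambda * (1 + b) / mu *
         ((1 - expR (- (mu * delta))) /
          (1 - (1 + b) * expR (- (mu * delta)))))%:E).
Proof.
set E := expR (- (mu * delta)).
have E0 : 0 < E by exact: expR_gt0.
have E1 : E < 1 by rewrite expR_lt1 oppr_lt0 mulr_gt0.
set A := lambda / mu * _.
(* The other closed form is regrouped as [(1 + b) * A]. *)
rewrite [lambda * (1 + b)]mulrC -!mulrA [lambda * (_ * _)]mulrA -/A.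
have A_ge0 : (1 + b) * E < 1 -> 0 <= A.
  by move=> r1; rewrite mulr_ge0 ?divr_ge0// ?subr_ge0 ltW.
have steady : -1 < b -> (1 + b) * E < 1 ->
    steady_lower q = (Num.min A ((1 + b) * A))%:E /\
    steady_upper q = (Num.max A ((1 + b) * A))%:E.
  move=> b1 r1; apply: impulsive_steady_state q_sol => //.
  by rewrite ger0_norm// mulr_ge0// ltW// -ltrBlDl sub0r.
split=> [b1 b0 r1|b0 bE].
  have [-> ->] := steady b1 r1.
  have bA : (1 + b) * A <= A by have := A_ge0 r1; nra.
  by rewrite (min_idPr bA) (max_idPl bA).
have r1 : (1 + b) * E < 1.
  (* Multiplied by [expR (mu * delta)], the contraction condition becomes the assumed bound on
     [b]. *)
  by rewrite /E expRN -ltr_pdivlMr ?invr_gt0 ?expR_gt0// invrK mul1r -ltrBrDl.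
have [|-> ->] := steady _ r1; first lra.
have bA : A <= (1 + b) * A by have := A_ge0 r1; nra.
by rewrite (min_idPl bA) (max_idPr bA).
Qed.
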